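(* Let $T\subseteq\Pi_n$ be a symmetric partition lattice of order $k$ and let $P\in\mathcal{M}(\mathbb{X}_n)$ be a probability measure. Then $T[P]\in\mathcal{M}_k(\mathbb{X}_n)$.
   Context: Let $n\ge2$. $\Pi_n$ denotes the set of all partitions of $\{1,\dots,n\}$ into nonempty disjoint blocks, ordered by refinement: $\pi\le\sigma$ iff every block of $\pi$ is contained in a block of $\sigma$. $\hat{\mathbf{0}}_n$ is the partition into singletons and $\hat{\mathbf{1}}_n$ the one-block partition. A subset $T\subseteq\Pi_n$ is called a lower set if it contains $\hat{\mathbf 0}_n$ and $\hat{\mathbf 1}_n$ and, for every $w\in T\setminus\{\hat{\mathbf 1}_n\}$ and $z\in\Pi_n$ with $z\le w$, one has $z\in T$. A symmetric partition lattice is a lower set $T\subseteq\Pi_n$ such that for every $\pi=(F_1,\dots,F_\ell)\in T$ and every bijection $\tau$ of $\{1,\dots,n\}$, $(\tau(F_1),\dots,\tau(F_\ell))\in T$. Its order is $|T|_\infty:=1+\max$ of the largest block size of $\pi$, over all $\pi\in T\setminus\{\hat{\mathbf 1}_n\}$. Such $T$ carries the induced order, and $\mu$ denotes the M\''obius function of the poset $T$: $\mu(x,x)=1$, $\mu(x,y)=-\sum_{z\in T,\,x\le z<y}\mu(x,z)$ for $x<y$ in $T$, and $\mu(x,y)=0$ otherwise. $X_1,\dots,X_n$ are nonempty sets, $\mathbb{X}_n=X_1\times\cdots\times X_n$, and $\mathcal{M}(\mathbb{X}_n)$ is the vector space of discrete signed measures on $\mathbb{X}_n$ (finite real linear combinations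 of Dirac measures). For a probability measure $P\in\mathcal{M}(\mathbb{X}_n)$ and nonempty $F\subseteq\{1,\dots,n\}$, $P_F$ is the marginal of $P$ on $\prod_{i\in F}X_i$; for $\pi=(F_1,\dots,F_\ell)\in\Pi_n$, $P_\pi:=P_{F_1}\times\cdots\times P_{F_\ell}$, viewed as a measure on $\mathbb{X}_n$. The interaction is the signed measure $T[P]:=\sum_{\pi\in T}\mu(\pi,\hat{\mathbf{1}}_n)P_\pi$. The vector space $\mathcal{M}_k(\mathbb{X}_n)$ is $$\mathcal{M}_k(\mathbb{X}_n):=\Big\{\eta\in\mathcal{M}(\mathbb{X}_n):\ \eta\big(\textstyle\prod_{i=1}^nA_i\big)=0\ \text{ whenever } A_i\subseteq X_i \text{ and } |\{i:A_i=X_i\}|\geq n-k+1\Big\}.$$ *)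

(* Defs.v *)
From HB Require Import structures.
From mathcomp Require Import all_boot all_order all_algebra all_fingroup.
From mathcomp Require Import all_classical all_reals all_analysis.

Set Implicit Arguments.
Unset Strict Implicit.
Unset Printing Implicit Defensive.

Import Order.TTheory GRing.Theory Num.Theory.

Local Open Scope classical_set_scope.
Local Open Scope ring_scope.

(* Moebius function of the subset T of a finite type, ordered by le.  The    *)
(* recursion on y is run with fuel #|T|, which is enough when le is a        *)
(* partial order on T: see mobius_eq, mobius_lt and mobius_nle.              *)
Section Mobius.
Variables (U : finType) (le : rel U) (T : {set U}).

Fixpoint mobius_rec (m : nat) (x y : U) : int :=
  if x == y then 1
  else if le x y then
    if m is m'.+1 then
      - \sum_(z in T | [&& le x z, le z y & z != y]) mobius_rec m' x z
    else 0
  else 0.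

Definition mobius (x y : U) : int := mobius_rec #|T| x y.

Lemma mobius_eq x : mobius x x = 1.
Proof. by rewrite /mobius; case: #|T| => [|m] /=; rewrite eqxx. Qed.

Lemma mobius_nle x y : x != y -> ~~ le x y -> mobius x y = 0.
Proof.
by move=> /negPf xy /negPf lxy; rewrite /mobius; case: #|T| => [|m] /=; rewrite xy lxy.
Qed.

Hypothesis le_anti : {in T &, forall x y, le x y -> le y x -> x = y}.
Hypothesis le_trans : {in T & &, forall y x z, le x y -> le y z -> le x z}.

Let below x y := [set z in T | [&& le x z, le z y & z != y]]%SET.

Let mobius_rec_fuel m1 m2 x y : x \in T -> y \in T -> le x x ->
  (#|below x y| <= m1)%N -> (#|below x y| <= m2)%N ->
  mobius_rec m1 x y = mobius_rec m2 x y.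
Proof.
move=> xT + lxx; elim: m1 m2 y => [|m1 IH] [|m2] y yT //=.
- rewrite leqn0 cards_eq0 => /eqP b0 _; case: eqVneq => // xy.
  case: ifPn => // lxy; have : x \in below x y by rewrite inE xT lxx lxy.
  by rewrite b0 inE.
- move=> _; rewrite leqn0 cards_eq0 => /eqP b0; case: eqVneq => // xy.
  case: ifPn => // lxy; have : x \in below x y by rewrite inE xT lxx lxy.
  by rewrite b0 inE.
move=> le1 le2; case: eqVneq => // xy; case: ifPn => // lxy.
congr (- _); apply: eq_bigr => z /andP[zT /and3P[lxz lzy zy]].
have ltb : (#|below x z| < #|below x y|)%N.
  apply: proper_card; apply/fintype.properP; split; last first.
    by exists z; rewrite !inE zT ?lxz ?lzy ?zy //= eqxx !andbF.
  apply/fintype.subsetP => w; rewrite !inE => /and4P[wT lxw lwz wz].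
  rewrite wT lxw (le_trans zT wT yT lwz lzy) /=.
  by apply: contraNneq zy => wy; apply/eqP/le_anti => //; rewrite -wy.
by apply: IH => //; rewrite -ltnS; exact: leq_trans ltb _.
Qed.

Lemma mobius_lt x y : x \in T -> y \in T -> le x x -> x != y -> le x y ->
  mobius x y = - \sum_(z in T | [&& le x z, le z y & z != y]) mobius x z.
Proof.
move=> xT yT lxx xy lxy.
have bT z : (#|below x z| <= #|T|)%N.
  by apply/subset_leq_card/fintype.subsetP => w; rewrite inE => /andP[].
rewrite /mobius (@mobius_rec_fuel _ #|T|.+1) ?leqW //=.
by rewrite (negPf xy) lxy.
Qed.

End Mobius.

Section Partitions.
Variable n : nat.
Implicit Types (p q : {set {set 'I_n}}) (T : {set {set {set 'I_n}}}).

Definition set_partitions : {set {set {set 'I_n}}} :=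
  [set p | finset.partition p [set: 'I_n]%SET]%SET.

Definition refines : rel {set {set 'I_n}} := fun p q =>
  [forall F in p, exists G in q, F \subset G].

Definition part_bot : {set {set 'I_n}} := [set [set i] | i : 'I_n]%SET.
Definition part_top : {set {set 'I_n}} := [set [set: 'I_n]]%SET.

Definition lower_set T : Prop :=
  [/\ T \subset set_partitions, part_bot \in T, part_top \in T &
    forall w z, w \in T -> w != part_top -> z \in set_partitions ->
      refines z w -> z \in T].

Definition symmetric_partition_lattice T : Prop :=
  lower_set T /\
  forall (p : {set {set 'I_n}}) (tau : {perm 'I_n}),
    p \in T -> [set tau @: (F : {set 'I_n}) | F in p]%SET \in T.

Definition lattice_order T : nat :=
  (1 + \max_(p in T | p != part_top) \max_(F in p) #|F|)%N.

Lemma refines_refl p : refines p p.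
Proof. by apply/forall_inP => F Fp; apply/exists_inP; exists F. Qed.

Lemma refines_trans q p r : refines p q -> refines q r -> refines p r.
Proof.
move=> /forall_inP pq /forall_inP qr; apply/forall_inP => F /pq.
move=> /exists_inP[G /qr/exists_inP[H Hr GH] FG].
by apply/exists_inP; exists H => //; exact: (fintype.subset_trans FG GH).
Qed.

Lemma refines_anti : {in set_partitions &, forall p q,
  refines p q -> refines q p -> p = q}.
Proof.
suff sub p q : p \in set_partitions -> refines p q -> refines q p -> p \subset q.
  by move=> p q pP qP pq qp; apply/eqP; rewrite finset.eqEsubset !sub.
rewrite inE => /and3P[_ /finset.trivIsetP tp p0] /forall_inP pq /forall_inP qp.
apply/fintype.subsetP => F Fp; have /exists_inP[G Gq FG] := pq _ Fp.
have /exists_inP[H Hp GH] := qp _ Gq.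
have FH : F = H.
  apply/eqP; apply: contraNT p0 => /(tp _ _ Fp Hp).
  by rewrite -finset.setI_eq0 (finset.setIidPl (fintype.subset_trans FG GH)) => /eqP <-.
suff -> : F = G by [].
by apply/eqP; rewrite finset.eqEsubset FG FH.
Qed.

End Partitions.

(* Signed measures are represented as set functions defined on all subsets. *)
Definition discrete_measure (R : realType) (U : Type) : set (set U -> R) :=
  [set eta | exists s : seq (R * U),
     forall A, eta A = \sum_(c <- s) c.1 * \1_A c.2].

Definition discrete_probability (R : realType) (U : Type) : set (set U -> R) :=
  [set P | [/\ discrete_measure P, forall A, 0 <= P A & P setT = 1]].

Section Interaction.
Variables (R : realType) (n : nat) (X : 'I_n -> choiceType).

Definition restr (F : {set 'I_n}) (x : forall i, X i) :
    forall i : {i : 'I_n | i \in F}, X (sval i) :=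
  fun i => x (sval i).
Arguments restr : clear implicits.

Definition marginal (P : set (forall i, X i) -> R) (F : {set 'I_n}) :
    set (forall i : {i : 'I_n | i \in F}, X (sval i)) -> R :=
  fun B => P (restr F @^-1` B).

(* The product of discrete measures nu_F (F in p) gives the point x the mass *)
(* \prod_F nu_F {x_F}; only finitely many x have nonzero mass when p is a    *)
(* partition of 'I_n, so that the sum below is a finite one.                 *)
Definition product_measure (p : {set {set 'I_n}})
    (nu : forall F : {set 'I_n},
       set (forall i : {i : 'I_n | i \in F}, X (sval i)) -> R) :
    set (forall i, X i) -> R :=
  fun A => \sum_(x \in A) \prod_(F in p) nu F [set restr F x].

Definition part_measure (P : set (forall i, X i) -> R) (p : {set {set 'I_n}}) :
    set (forall i, X i) -> R :=
  product_measure p (marginal P).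

Definition interaction (T : {set {set {set 'I_n}}})
    (P : set (forall i, X i) -> R) : set (forall i, X i) -> R :=
  fun A => \sum_(p in T)
    (mobius (@refines n) T p (part_top n))%:~R * part_measure P p A.

Definition rectangle (A : forall i, set (X i)) : set (forall i, X i) :=
  [set x | forall i, A i (x i)].

(* The bound #|{i | A i = X i}| >= n - k + 1 is written without truncated    *)
(* subtraction.                                                              *)
Definition vanishing_measure (k : nat) : set (set (forall i, X i) -> R) :=
  [set eta | discrete_measure eta /\
     forall A : forall i, set (X i),
       (n + 1 <= #|[set i | `[< A i = setT >]]%SET| + k)%N ->
       eta (rectangle A) = 0].

End Interaction.

(* Main.v *)
Require Import Defs.
From mathcomp Require Import all_boot all_order all_algebra all_fingroup.
From mathcomp Require Import all_classical all_reals all_analysis.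

Set Implicit Arguments.
Unset Strict Implicit.
Unset Printing Implicit Defensive.

Import Order.TTheory GRing.Theory Num.Theory.

Local Open Scope classical_set_scope.
Local Open Scope ring_scope.

(** Let [A] be a rectangle with at most [k - 1] proper sides, and let [S] be the
    set of indices of those sides.  Each [P_p] is a product of marginals, so
    [P_p A] is the product over the blocks [F] of [p] of the [P]-mass of the
    cylinder constrained on [F] only.  The sides outside [S] impose nothing, and
    [P] has mass [1]; hence [P_p A] depends only on the trace of [p] on [S], the
    set of nonempty [F :&: S] ([prod_trace]).

    Some [a] in [T], different from the top, has a block of size [k - 1]; by
    symmetry of [T] it can be moved so that this block contains [S]
    ([exists_block_containing]).  Then [p] and its meet with [a] have the same
    trace on [S] ([trace_common_refinement]), and the meet stays in [T] because
    [T] is a lower set.  Therefore the interaction evaluated at [A] has the form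
    [\sum_p mu(p, 1) f(p /\ a)], and such a sum vanishes for every [f] as soon as
    [a] is not the top: this is Weisner's theorem ([sum_mobius_meet]).

    The remaining work is to see that [P_p], defined by its point masses, is
    again a finite combination of Dirac measures and takes the expected product
    value on rectangles ([part_measureP]).  Both follow by expanding the product
    over the blocks: choosing one atom of [P] per block and gluing their
    coordinates yields the atoms of [P_p]. *)

(** * Moebius inversion and Weisner's theorem *)

Section MobiusInversion.
Variables (U : finType) (le : rel U) (T : {set U}).
Hypothesis le_refl : forall x, le x x.
Hypothesis le_anti : {in T &, forall x y, le x y -> le y x -> x = y}.
Hypothesis le_trans : {in T & &, forall y x z, le x y -> le y z -> le x z}.

Local Notation mu := (mobius le T).

Lemma sum_mobius_lower x y : x \in T -> y \in T ->
  \sum_(z in T | le z y) mu x z = (x == y)%:R.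
Proof.
move=> xT yT.
have -> : \sum_(z in T | le z y) mu x z = \sum_(z in T | le x z && le z y) mu x z.
  rewrite big_mkcond [RHS]big_mkcond /=; apply: eq_bigr => z _.
  case: (z \in T) => //=; case: (boolP (le x z)) => //= xz.
  have zx : x != z by apply: contraNneq xz => <-.
  by rewrite mobius_nle //; case: ifP.
case: (boolP (le x y)) => [lxy|nxy]; last first.
  rewrite big1 => [|z /and3P[zT xz zy]].
    by case: eqP nxy => // ->; rewrite le_refl.
  by rewrite (@le_trans z x y zT xT yT xz zy) in nxy.
case: eqVneq => [<-|xy].
  rewrite (bigD1 x) /= ?xT ?le_refl // mobius_eq big1 ?addr0 //.
  move=> z /andP[/and3P[zT xz zx]].
  by rewrite (@le_anti z x zT xT zx xz) eqxx.
rewrite (bigD1 y) /= ?yT ?lxy ?le_refl // mobius_lt //.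
apply/eqP; rewrite addrC subr_eq0; apply/eqP.
by apply: eq_bigl => z; rewrite -!andbA.
Qed.

(** The recursion defining [mu] controls the sums over its second argument: as
    matrices indexed by [T], [mu] times zeta is the identity.  A one-sided inverse
    of a square matrix is two-sided, which gives the sums over the first one. *)
Lemma sum_mobius_upper x y : x \in T -> y \in T ->
  \sum_(z in T | le x z) mu z y = (x == y)%:R.
Proof.
move=> xT yT.
pose M : 'M[int]_#|T| := \matrix_(i, j) mu (enum_val i) (enum_val j).
pose Z : 'M[int]_#|T| := \matrix_(i, j) (le (enum_val i) (enum_val j))%:R.
have MZ : M *m Z = 1%:M.
  apply/matrixP => i j; rewrite !mxE.
  rewrite -(inj_eq enum_val_inj) -sum_mobius_lower ?enum_valP //.
  rewrite [RHS]big_mkcondr [RHS]big_enum_val; apply: eq_bigr => l _; rewrite !mxE.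
  by case: ifP => _; rewrite ?mulr1 ?mulr0.
have /matrixP/(_ (enum_rank_in xT x) (enum_rank_in yT y)) := mulmx1C MZ.
rewrite !mxE -(inj_eq enum_val_inj) !enum_rankK_in // => <-.
rewrite big_mkcondr big_enum_val; apply: eq_bigr => l _.
rewrite !mxE !enum_rankK_in //.
by case: ifP => _; rewrite ?mul1r ?mul0r.
Qed.

(** Weisner's theorem, in the form of a functional identity.  Moebius inversion
    writes [f b] as the sum of [g c] over [c] below [b]; for [b] the meet of [x]
    and [a], the condition on [c] splits into [c] below [x] and [c] below [a].
    Exchanging the sums leaves, for each [c] below [a], the sum of [mu x top] over
    [x] above [c], which is zero because [c] is not the top. *)
Lemma sum_mobius_meet (R : comPzRingType) (a top : U) (meet : U -> U) (f : U -> R) :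
    a \in T -> top \in T -> (forall x, x \in T -> le x top) -> a != top ->
    {in T, forall x, meet x \in T} ->
    {in T &, forall x c, le c (meet x) = le c x && le c a} ->
  \sum_(x in T) (mu x top)%:~R * f (meet x) = 0.
Proof.
move=> aT topT letop atop meetT le_meet.
pose g c := \sum_(b in T) (mu b c)%:~R * f b.
have fE b : b \in T -> f b = \sum_(c in T | le c b) g c.
  move=> bT; rewrite exchange_big (bigD1 b) //= -mulr_suml -rmorph_sum /=.
  rewrite sum_mobius_lower // eqxx mul1r big1 ?addr0 // => b' /andP[b'T /negPf bb].
  by rewrite -mulr_suml -rmorph_sum /= sum_mobius_lower // bb mul0r.
transitivity (\sum_(x in T) \sum_(c in T | le c x && le c a)
    (mu x top)%:~R * g c).
  apply: eq_bigr => x xT; rewrite fE ?meetT // mulr_sumr.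
  by apply: eq_bigl => c; case: (boolP (c \in T)) => //= cT; rewrite le_meet.
rewrite (exchange_big_dep (fun c => (c \in T) && le c a)) /=; last first.
  by move=> x c _ /and3P[-> _ ->].
rewrite big1 // => c /andP[cT ca].
rewrite (eq_bigl (fun x => (x \in T) && le c x)); last first.
  by move=> x; rewrite cT ca andbT.
rewrite -mulr_suml -rmorph_sum /= sum_mobius_upper //.
case: eqVneq => [ctop|]; last by rewrite mul0r.
by case/eqP: atop; apply: le_anti => //; rewrite ?letop // -ctop.
Qed.

End MobiusInversion.

(** * Traces and common refinements of set partitions *)

Section Blocks.
Variable n : nat.
Implicit Types (F G S : {set 'I_n}) (p a c : {set {set 'I_n}}).

Definition trace S p : {set {set 'I_n}} :=
  ([set F :&: S | F in p] :\ finset.set0)%SET.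

(** The meet of [p] and [a] in the lattice of all set partitions, obtained by
    cutting every block of [a] along [p]. *)
Definition common_refinement p a : {set {set 'I_n}} :=
  (\bigcup_(G in a) trace G p)%SET.


Lemma common_refinementP p a F :
  reflect (exists E G, [/\ E \in p, G \in a, F = (E :&: G)%SET & F != finset.set0])
    (F \in common_refinement p a).
Proof.
apply: (iffP bigcupP) => [[G Ga]|[E [G [Ep Ga FE F0]]]].
  by rewrite !inE => /andP[F0 /imsetP[E Ep FE]]; exists E, G.
by exists G => //; rewrite in_setD1 F0 FE; apply: imset_f.
Qed.

Lemma partition_block_eq p i E F : finset.partition p [set: 'I_n]%SET ->
  E \in p -> F \in p -> i \in E -> i \in F -> E = F.
Proof.
case/and3P=> _ tp _ Ep Fp iE iF.
by rewrite -(def_pblock tp Ep iE) (def_pblock tp Fp iF).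
Qed.

Lemma partition_pblock p i : finset.partition p [set: 'I_n]%SET ->
  finset.pblock p i \in p /\ i \in finset.pblock p i.
Proof.
case/and3P=> /eqP cp _ _.
have ip : i \in finset.cover p by rewrite cp inE.
by rewrite finset.pblock_mem ?finset.mem_pblock.
Qed.

Lemma common_refinement_partition p a :
  p \in set_partitions n -> a \in set_partitions n ->
  common_refinement p a \in set_partitions n.
Proof.
rewrite !inE => pP aP; apply/and3P; split.
- apply/eqP/setP => i; rewrite [RHS]inE; apply/bigcupP.
  have [pp ip] := partition_pblock i pP; have [pa ia] := partition_pblock i aP.
  exists (finset.pblock p i :&: finset.pblock a i)%SET; last by rewrite inE ip ia.
  apply/common_refinementP; exists (finset.pblock p i), (finset.pblock a i); split=> //.
  by apply/set0Pn; exists i; rewrite inE ip ia.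
- apply/finset.trivIsetP => E F.
  move=> /common_refinementP[E1 [E2 [E1p E2a -> _]]].
  move=> /common_refinementP[F1 [F2 [F1p F2a -> _]]].
  apply: contraNT => /pred0Pn[i /andP[/=]].
  rewrite !inE => /andP[i1 i2] /andP[i3 i4].
  by rewrite (partition_block_eq pP E1p F1p i1 i3) (partition_block_eq aP E2a F2a i2 i4).
- by apply/negP => /common_refinementP[E [G [_ _ _]]]; rewrite eqxx.
Qed.

Lemma refines_common_refinement p a c : finset.set0 \notin c ->
  refines c (common_refinement p a) = refines c p && refines c a.
Proof.
move=> c0; apply/idP/andP => [cpa|[/forall_inP cp /forall_inP ca]].
  have sub q : refines (common_refinement p a) q -> refines c q.
    exact: refines_trans.
  split; apply: sub; apply/forall_inP => F /common_refinementP[E [G [Ep Ga -> _]]];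
    apply/exists_inP; [exists E | exists G] => //.
  - exact: finset.subsetIl.
  - exact: finset.subsetIr.
apply/forall_inP => F Fc; apply/exists_inP.
have /exists_inP[E Ep FE] := cp F Fc; have /exists_inP[G Ga FG] := ca F Fc.
have FEG : F \subset (E :&: G)%SET by rewrite finset.subsetI FE FG.
exists (E :&: G)%SET => //; apply/common_refinementP; exists E, G; split=> //.
by apply: contraNneq c0 => EG0; move: FEG; rewrite EG0 finset.subset0 => /eqP <-.
Qed.

(** Only the block [G] of [a] meets [S], and it contains [S]: cutting [p] along
    [a] does not separate points of [S]. *)
Lemma trace_common_refinement S G p a : finset.partition a [set: 'I_n]%SET ->
  G \in a -> S \subset G -> trace S (common_refinement p a) = trace S p.
Proof.
move=> aP Ga SG; apply/setP => H; rewrite !inE; case: eqVneq => //= H0.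
apply/imsetP/imsetP => -[F].
  move=> /common_refinementP[E [G' [Ep G'a -> _]]] HE; exists E => //.
  have /set0Pn[i] := H0; rewrite {1}HE !inE => /andP[/andP[iE iG'] iS].
  have GG' := partition_block_eq aP G'a Ga iG' (fintype.subsetP SG i iS).
  by rewrite HE GG' -finset.setIA (finset.setIidPr SG).
move=> Fp HF; have FGS : (F :&: G :&: S = H)%SET.
  by rewrite -finset.setIA (finset.setIidPr SG) HF.
exists (F :&: G)%SET => //; apply/common_refinementP; exists F, G; split=> //.
by apply: contraNneq H0 => FG0; rewrite -FGS FG0 finset.set0I.
Qed.

(** The map from [F] to [F :&: S] is injective on the blocks that meet [S], and
    the other blocks contribute [h set0 = 1]. *)
Lemma prod_trace (R : comPzRingType) (h : {set 'I_n} -> R) S p :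
    finset.partition p [set: 'I_n]%SET -> h finset.set0 = 1 ->
    (forall F, h F = h (F :&: S)%SET) ->
  \prod_(F in p) h F = \prod_(E in trace S p) h E.
Proof.
move=> pP h0 hS.
rewrite (eq_bigr _ (fun F _ => hS F)) (partition_big_imset (fun F => F :&: S)%SET) /=.
rewrite (bigID (pred1 finset.set0)) /= big1 ?mul1r => [|E /andP[_ /eqP ->]]; last first.
  by rewrite big1 // => F /andP[_ /eqP ->].
apply: eq_big => [E|E /andP[/imsetP[F Fp ->] FS0]]; first by rewrite !inE andbC.
rewrite (bigD1 F) /= ?Fp ?eqxx // big1 ?mulr1 // => G /andP[/andP[Gp /eqP GS] GF].
have /set0Pn[i] := FS0; rewrite -{1}GS => /[dup]; rewrite {2}GS !inE.
move=> /andP[iG _] /andP[iF _].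
by rewrite (partition_block_eq pP Gp Fp iG iF) eqxx in GF.
Qed.

(** List [F] before its complement, and [S] before its complement; the
    permutation matching the two lists position by position sends the first
    [#|S|] elements of [F] onto [S]. *)
Lemma perm_cover_set S F : (#|S| <= #|F|)%N ->
  exists tau : {perm 'I_n}, S \subset (tau @: F)%SET.
Proof.
move=> SF.
pose listing (B : {set 'I_n}) := enum B ++ enum (~: B)%SET.
have mem_listing B i : i \in listing B.
  by rewrite mem_cat !mem_enum inE orbN.
have uniq_listing B : uniq (listing B).
  rewrite cat_uniq !enum_uniq /= andbT; apply/hasPn => i.
  by rewrite !mem_enum inE.
have size_listing B C : size (listing B) = size (listing C).
  by rewrite !size_cat -!cardE !cardsC.
pose sigma i := nth i (listing S) (index i (listing F)).
have sigmaE i0 i : sigma i = nth i0 (listing S) (index i (listing F)).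
  by apply: set_nth_default; rewrite (size_listing S F) index_mem.
have sigma_inj : injective sigma.
  move=> i j; rewrite (sigmaE i i) (sigmaE i j) => /eqP.
  rewrite nth_uniq ?uniq_listing // ?(size_listing S F) ?index_mem //.
  by move=> /eqP ij; rewrite -(nth_index i (mem_listing F i)) ij nth_index.
exists (perm sigma_inj); apply/fintype.subsetP => i iS; apply/imsetP.
have iS' : (index i (listing S) < #|S|)%N.
  by rewrite index_cat mem_enum iS cardE index_mem mem_enum.
have iF := leq_trans iS' SF.
exists (nth i (listing F) (index i (listing S))).
  by rewrite nth_cat -cardE iF -mem_enum mem_nth // -cardE.
rewrite permE (sigmaE i) index_uniq ?nth_index //.
by rewrite (size_listing F S) index_mem.
Qed.

(** This is where symmetry enters: the order of [T] only provides one large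
    block, and a permutation moves it over [S]. *)
Lemma exists_block_containing T S : (2 <= n)%N ->
    symmetric_partition_lattice T -> (#|S| < lattice_order T)%N ->
  exists a G, [/\ a \in T, a != part_top n, G \in a & S \subset G].
Proof.
move=> n2 [[Tsub botT _ _] symT]; rewrite /lattice_order add1n ltnS => Sle.
have i0 : 'I_n by exact: Ordinal (ltnW n2).
have bot_top : part_bot n != part_top n.
  apply/eqP => bt; have : [set i0]%SET \in part_bot n by apply: imset_f.
  rewrite bt inE => /eqP/(congr1 (fun B : {set 'I_n} => #|B|)).
  by rewrite cards1 cardsT card_ord => n1; rewrite -n1 in n2.
have [|p] := @eq_bigmax_cond _ [pred p | (p \in T) && (p != part_top n)]
    (fun p => \max_(F in p) #|F|)%N.
  by apply/card_gt0P; exists (part_bot n); rewrite inE botT.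
rewrite inE => /andP[pT ptop] maxp.
have pP : finset.partition p [set: 'I_n]%SET.
  by have := fintype.subsetP Tsub p pT; rewrite inE.
have [|F Fp maxF] := @eq_bigmax_cond _ (mem p) (fun F : {set 'I_n} => #|F|).
  by apply/card_gt0P; exists (finset.pblock p i0); case: (partition_pblock i0 pP).
have [tau StauF] := perm_cover_set (leq_trans Sle (eq_leq (etrans maxp maxF))).
exists [set tau @: (B : {set 'I_n}) | B in p]%SET, (tau @: F)%SET.
split=> //; [exact: symT| |exact: imset_f].
(* Relabelling by [tau] is injective and fixes the top, so the image of [p] is
   not the top. *)
have tauK : cancel (fun B : {set 'I_n} => tau @: B)%SET
    (fun B : {set 'I_n} => tau^-1%g @: B)%SET.
  move=> B; rewrite -imset_comp -[RHS]imset_id; apply: eq_imset => i /=.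
  by rewrite permK.
apply: contra ptop => /eqP ptau; apply/eqP.
rewrite -[p]imset_id -(eq_imset _ tauK) (imset_comp (fun B : {set 'I_n} => tau^-1%g @: B)%SET) ptau.
rewrite /part_top imset_set1; congr [set _]%SET; apply/setP => i; rewrite !inE.
by apply/imsetP; exists (tau i); rewrite ?inE ?permK.
Qed.

End Blocks.

(** * Discrete measures and products of marginals *)

Lemma discrete_measure_sum (R : realType) (U : Type) (I : Type) (r : seq I)
    (Q : pred I) (c : I -> R) (m : I -> set U -> R) :
  (forall i, Q i -> discrete_measure (m i)) ->
  discrete_measure (fun A => \sum_(i <- r | Q i) c i * m i A).
Proof.
move=> mD; elim: r => [|i r [s sE]].
  by exists [::] => A; rewrite !big_nil.
case: (boolP (Q i)) => Qi; last first.
  by exists s => A; rewrite big_cons (negPf Qi).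
have [s' s'E] := mD i Qi.
exists ([seq (c i * d.1, d.2) | d <- s'] ++ s) => A.
rewrite big_cons Qi big_cat big_map -sE s'E mulr_sumr /=.
by congr (_ + _); apply: eq_bigr => d _; rewrite mulrA.
Qed.

(** The sum over [A] is a genuine finite one, since the points outside the list
    of atoms have no mass. *)
Lemma discrete_measure_points {R : realType} {U : choiceType} (eta : set U -> R)
    (A : set U) :
  discrete_measure eta -> \sum_(x \in A) eta [set x] = eta A.
Proof.
move=> [s sE]; rewrite sE.
pose r := [seq x <- undup [seq c.2 | c <- s] | x \in A].
rewrite (fsbigE r); first last.
- move=> x Ax; rewrite mem_filter mem_set //= mem_undup => xs.
  rewrite sE big_seq big1 // => c cs; rewrite indicE memNset ?mulr0 //= => cx.
  by move/negP: xs; apply; apply/mapP; exists c.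
- by move=> x /=; rewrite mem_filter => /andP[/set_mem].
- by rewrite filter_uniq // undup_uniq.
under eq_bigr do rewrite sE.
rewrite exchange_big /=; apply: eq_big_seq => c cs.
rewrite -mulr_sumr; congr (_ * _); rewrite indicE.
have [cA|cA] := boolP (c.2 \in A).
  rewrite big_mkcond (bigD1_seq c.2) /= ?filter_uniq ?undup_uniq //; last first.
    by rewrite mem_filter cA mem_undup map_f.
  rewrite cA indicE mem_set // big1 ?addr0 // => x /eqP xc.
  by case: ifP => // _; rewrite indicE memNset // => cx; apply: xc.
rewrite big1 // => x xA; rewrite indicE memNset // => cx.
by rewrite cx xA in cA.
Qed.

Section PartMeasure.
Variables (R : realType) (n : nat) (X : 'I_n -> choiceType).
Implicit Types (A : forall i, set (X i)) (p : {set {set 'I_n}}).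

Definition cylinder A (F : {set 'I_n}) : set (forall i, X i) :=
  [set x | forall i, i \in F -> A i (x i)].

Lemma cylinder_setI A (S F : {set 'I_n}) :
  (forall i, i \notin S -> A i = setT) -> cylinder A F = cylinder A (F :&: S)%SET.
Proof.
move=> AS; apply/seteqP; split=> x xA i; first by rewrite inE => /andP[/xA].
case: (boolP (i \in S)) => [iS iF|/AS -> //]; by apply: xA; rewrite inE iF.
Qed.

Section Gluing.
Variables (J : finType) (j0 : J) (w : J -> R) (y : J -> forall i, X i).
Variable P : set (forall i, X i) -> R.
Hypothesis PE : forall B, P B = \sum_j w j * \1_B (y j).

(** The point whose coordinates in the block [F] of [p] are those of the atom
    chosen by [phi] for [F]. *)
Definition glue p (phi : {set 'I_n} -> J) : forall i, X i :=
  fun i => y (phi (finset.pblock p i)) i.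

Lemma prod_indic_glue p (phi : {set 'I_n} -> J) A :
  finset.partition p [set: 'I_n]%SET ->
  \prod_(F in p) \1_(cylinder A F) (y (phi F)) = \1_(rectangle A) (glue p phi) :> R.
Proof.
move=> pP; rewrite indicE; have [/set_mem gA|gA] := boolP (glue p phi \in rectangle A).
  rewrite big1 // => F Fp; rewrite indicE mem_set // => i iF.
  have := gA i; rewrite /glue; have [pp ip] := partition_pblock i pP.
  by rewrite (partition_block_eq pP pp Fp ip iF).
apply/eqP; rewrite prodf_seq_eq0; apply: contraNT gA => /hasPn allA.
apply/mem_set => i; have [pp ip] := partition_pblock i pP.
have := allA (finset.pblock p i); rewrite mem_index_enum pp /= => /(_ isT).
rewrite indicE pnatr_eq0 eqb0 negbK => /set_mem; exact.
Qed.

(** Distributivity over the blocks.  With singleton sides this computes the point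
    masses of [P_p], with general sides its value on rectangles; [j0] is the
    default value of the choice functions [phi] outside [p]. *)
Lemma prod_cylinder p A : finset.partition p [set: 'I_n]%SET ->
  \prod_(F in p) P (cylinder A F) =
  \sum_(phi in pffun_on j0 (mem p) predT)
    (\prod_(F in p) w (phi F)) * \1_(rectangle A) (glue p phi).
Proof.
move=> pP; rewrite (eq_bigr _ (fun F _ => PE (cylinder A F))).
rewrite (big_distr_big j0) /=; apply: eq_bigr => phi _.
by rewrite big_split /= prod_indic_glue.
Qed.

End Gluing.

Lemma marginal_point (P : set (forall i, X i) -> R) (F : {set 'I_n}) x :
  marginal P [set @restr n X F x] = P (cylinder (fun i => [set x i]) F).
Proof.
congr (P _); apply/seteqP; split=> z /= zx.
  by move=> i iF; have := congr1 (fun g => g (exist _ i iF)) zx.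
by apply: functional_extensionality_dep => -[i iF]; exact: zx.
Qed.

Lemma rectangle_point (x : forall i, X i) : rectangle (fun i => [set x i]) = [set x].
Proof.
apply/seteqP; split=> z /= zx; last by move=> i; rewrite zx.
by apply: functional_extensionality_dep => i; exact: zx.
Qed.

(** The discrete measure [eta] carried by the glued atoms has the point masses
    that define [P_p], so the two agree on every set. *)
Lemma part_measureP (P : set (forall i, X i) -> R) p :
  discrete_probability P -> finset.partition p [set: 'I_n]%SET ->
  discrete_measure (part_measure P p) /\
  forall A, part_measure P p (rectangle A) = \prod_(F in p) P (cylinder A F).
Proof.
move=> [[s sE] _ PT] pP.
(* [P] has total mass [1], so its list of atoms provides a default index. *)
case: s sE => [|c0 s] sE.
  by have := oner_neq0 R; rewrite -PT sE big_nil eqxx.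
set t := c0 :: s in sE.
pose j0 : 'I_(size t) := Ordinal (ltn0Sn (size s)).
pose w (j : 'I_(size t)) := (tnth (in_tuple t) j).1.
pose y (j : 'I_(size t)) := (tnth (in_tuple t) j).2.
have PE B : P B = \sum_j w j * \1_B (y j) by rewrite sE big_tnth.
pose eta B := \sum_(phi in pffun_on j0 (mem p) predT)
  (\prod_(F in p) w (phi F)) * \1_B (glue y p phi).
have etaD : discrete_measure eta.
  exists [seq (\prod_(F in p) w (phi F), glue y p phi) |
    phi : {ffun {set 'I_n} -> 'I_(size t)} <- enum (pffun_on j0 (mem p) predT)] => B.
  by rewrite big_map big_enum.
have -> : part_measure P p = eta.
  apply/funext => B; rewrite -(discrete_measure_points B etaD).
  apply: eq_fsbigr => x _.
  transitivity (\prod_(F in p) P (cylinder (fun i => [set x i]) F)).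
    by apply: eq_bigr => F _; exact: marginal_point.
  by rewrite (prod_cylinder j0 PE) // rectangle_point.
by split=> // A; rewrite (prod_cylinder j0 PE).
Qed.

End PartMeasure.

(** * Vanishing of the interaction *)

Theorem theorem3p11 (R : realType) (n k : nat) (X : 'I_n -> choiceType)
    (T : {set {set {set 'I_n}}}) (P : set (forall i, X i) -> R)
    (hn : (2 <= n)%N)
    (hX : forall i, [set: X i] !=set0)
    (hT : symmetric_partition_lattice T)
    (hk : lattice_order T = k)
    (hP : discrete_probability P) :
  vanishing_measure k (interaction T P).
Proof.
have [[Tsub _ topT lowerT] _] := hT.
have TP p : p \in T -> finset.partition p [set: 'I_n]%SET.
  by move=> pT; have := fintype.subsetP Tsub p pT; rewrite inE.
split.
  by apply: discrete_measure_sum => p /TP pP; have [] := part_measureP hP pP.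
move=> A Ak; pose S := [set i | ~~ `[< A i = setT >]]%SET.
have AS i : i \notin S -> A i = setT by rewrite inE negbK => /asboolP.
have Sk : (#|S| < lattice_order T)%N.
  rewrite hk -(leq_add2l #|[set i | `[< A i = setT >]]%SET|).
  have -> : S = (~: [set i | `[< A i = setT >]])%SET by apply/setP => i; rewrite !inE.
  by rewrite addnS cardsC card_ord -addn1.
have [a [G [aT atop Ga SG]]] := exists_block_containing hn hT Sk.
pose h F := P (cylinder A F).
pose f p := \prod_(E in trace S p) h E.
have h0 : h finset.set0 = 1.
  have [_ _ <-] := hP; congr (P _); apply/seteqP; split=> // x _ i.
  by rewrite inE.
have hS F : h F = h (F :&: S)%SET by rewrite /h (cylinder_setI F AS).
have fE p : p \in T -> part_measure P p (rectangle A) = f p.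
  move=> pT; have [_ ->] := part_measureP hP (TP _ pT).
  exact: prod_trace (TP _ pT) h0 hS.
have meetT p : p \in T -> common_refinement p a \in T.
  move=> pT; have mP : common_refinement p a \in set_partitions n.
    by apply: common_refinement_partition; rewrite inE TP.
  apply: (lowerT a) => //; have m0 : finset.set0 \notin common_refinement p a.
    by move: mP; rewrite inE => /and3P[].
  by have := refines_common_refinement p a m0; rewrite refines_refl => /esym/andP[].
rewrite /interaction -[RHS](@sum_mobius_meet _ (@refines n) T (@refines_refl n)
  _ _ R a (part_top n) (fun p => common_refinement p a) f) //.
- by apply: eq_bigr => p pT; rewrite fE // /f (trace_common_refinement p (TP _ aT) Ga SG).
- by move=> p q pT qT; apply: refines_anti; apply: (fintype.subsetP Tsub).
- by move=> q p r _ _ _; exact: refines_trans.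
- move=> p _; apply/forall_inP => F _; apply/exists_inP.
  by exists [set: 'I_n]%SET; rewrite ?inE // finset.subsetT.
- by move=> p c pT cT; apply: refines_common_refinement; have /and3P[] := TP _ cT.
Qed.
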